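(* There is an absolute constant $c>0$ such that the following holds. Let $A$ be an $n\times n$ matrix whose entries $Y_{ij}$ are independent random variables, each moment bounded with parameter $L=1$ and with $\mathbb E[Y_{ij}]=0$. Let $P(A)=\sum_{\pi\in S_n}\prod_{i=1}^n Y_{i\pi(i)}$ be the permanent of $A$. Then for every $t>0$, $$\Pr\big[|P(A)|\ge t\sqrt{n!}\big]\le \max\left\{e^{-n},\ e^2\cdot e^{-c\,t^{2/n}}\right\}.$$
   Context: A random variable $Z$ is moment bounded with parameter $L>0$ if for every integer $i\ge1$, $\mathbb E[|Z|^i]\le iL\,\mathbb E[|Z|^{i-1}]$. *)

(* Defs.v *)
From HB Require Import structures.
From mathcomp Require Import all_boot all_order all_algebra all_fingroup.
From mathcomp Require Import all_classical all_reals all_analysis.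

Set Implicit Arguments.
Unset Strict Implicit.
Unset Printing Implicit Defensive.
Import Order.TTheory GRing.Theory Num.Theory.

Local Open Scope classical_set_scope.
Local Open Scope ring_scope.

Definition moment_bounded d (T : measurableType d) (R : realType)
  (P : probability T R) (L : R) (Z : T -> R) : Prop :=
  forall i : nat, (0 < i)%N ->
    ('E_P[fun w => (`|Z w| ^+ i)%R] <=
       (i%:R * L)%:E * 'E_P[fun w => (`|Z w| ^+ i.-1)%R])%E.

Definition mutually_independent d (T : measurableType d) (R : realType)
  (P : probability T R) (I : finType) (Y : I -> T -> R) : Prop :=
  forall (J : {set I}) (B : I -> set R),
    (forall i, measurable (B i)) ->
    P (\bigcap_(i in [set` J]) (Y i @^-1` B i)) =
      (\prod_(i in J) P (Y i @^-1` B i))%E.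

Definition rperm d (T : measurableType d) (R : realType) (n : nat)
  (Y : 'I_n -> 'I_n -> T -> R) : T -> R :=
  fun w => \sum_(s : 'S_n) \prod_(i < n) Y i (s i) w.

(* Main.v *)
(** Chebyshev's inequality suffices.  By independence and centring, distinct
    permutations give orthogonal monomials, and [E|Z|^2 <= 2 E|Z| <= 2] for each
    entry, so [E[P(A)^2] <= n! 2^n].  With [x = t^(2/n)] the probability is thus
    at most [2^n / t^2 = (2/x)^n].  If [x > 2e] this is at most [e^-n]; if
    [x <= 2e] then [c = 1/e] gives [e^2 e^(-c x) >= 1]. *)

Require Import Defs.
From HB Require Import structures.
From mathcomp Require Import all_boot all_order all_algebra all_fingroup.
From mathcomp Require Import all_classical all_reals all_analysis.
From mathcomp Require Import measurable_realfun.
Import Order.TTheory GRing.Theory Num.Theory.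
Local Open Scope classical_set_scope.
Local Open Scope ring_scope.

(** * Factoring out an independent weight: from indicators to nonnegative functions *)

Section integral_comp_indic.
Context {d : measure_display} {T : measurableType d} {R : realType}.
Variables (P : probability T R) (X g : T -> R) (c : R).
Hypotheses (mX : measurable_fun setT X) (mg : measurable_fun setT g).
Hypotheses (g0 : forall w, 0 <= g w) (c0 : 0 <= c).
Hypothesis indep : forall B : set R, measurable B ->
  (\int[P]_w (\1_B (X w) * g w)%:E = \int[P]_w (\1_B (X w))%:E * c%:E)%E.

Import HBNNSimple finmap.

(** [g] stands for the remaining factors of a product and [c] for its expectation, as [indep] with
    [B] the whole line shows. A nonnegative simple function is a finite nonnegative combination of
    indicators of its level sets, so [indep] extends to it by linearity. *)
Lemma integral_nnsfun_comp_mul (s : {nnsfun R >-> R}) :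
  (\int[P]_w (s (X w) * g w)%:E = \int[P]_w (s (X w))%:E * c%:E)%E.
Proof.
pose r : seq R := fset_set (range s).
pose A (i : 'I_(size r)) := s @^-1` [set r`_i].
have mA i : measurable (A i) by exact: measurable_funPTI.
have r0 (i : 'I_(size r)) : 0 <= r`_i.
  have : r`_i \in fset_set (range s) by exact: mem_nth.
  by rewrite in_fset_set// => /set_mem[x _ <-].
have mI i : measurable_fun setT (fun w => \1_(A i) (X w) : R).
  by apply: measurableT_comp mX; exact: measurable_indic.
have sE x : s x = \sum_(i < size r) r`_i * \1_(A i) x by exact: fimfunEord.
transitivity (\sum_(i < size r) (r`_i)%:E * (\int[P]_w (\1_(A i) (X w) * g w)%:E))%E.
  under eq_integral do rewrite sE mulr_suml -sumEFin.
  rewrite ge0_integral_sum//.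
  - apply: eq_bigr => i _; rewrite -ge0_integralZl_EFin//.
    + by apply: eq_integral => w _; rewrite -EFinM mulrA.
    + by move=> w _; rewrite lee_fin mulr_ge0.
    + by apply/measurable_EFinP; exact: measurable_funM.
  - move=> i; apply/measurable_EFinP; apply: measurable_funM => //.
    exact: measurable_funM.
  - by move=> i w _; rewrite lee_fin !mulr_ge0.
transitivity ((\sum_(i < size r) (r`_i)%:E * (\int[P]_w (\1_(A i) (X w))%:E)) * c%:E)%E.
  rewrite ge0_sume_distrl; last first.
    move=> i _; rewrite mule_ge0 ?lee_fin//; apply: integral_ge0 => w _.
    by rewrite lee_fin.
  by apply: eq_bigr => i _; rewrite indep// muleA.
congr (_ * _)%E.
under [RHS]eq_integral do rewrite sE -sumEFin.
rewrite ge0_integral_sum//.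
- apply: eq_bigr => i _; rewrite -ge0_integralZl_EFin//.
  by apply/measurable_EFinP; exact: mI.
- by move=> i; apply/measurable_EFinP; exact: measurable_funM.
- by move=> i w _; rewrite lee_fin mulr_ge0.
Qed.

(** Simple functions increasing to [h] give the identity in the limit, by monotone convergence on
    both sides; as [c] is real, multiplication by it preserves the right-hand limit. *)
Lemma integral_ge0_comp_mul (h : R -> R) :
  measurable_fun setT h -> (forall x, 0 <= h x) ->
  (\int[P]_w (h (X w) * g w)%:E = \int[P]_w (h (X w))%:E * c%:E)%E.
Proof.
move=> mh h0.
have mEh : measurable_fun setT (EFin \o h) by exact/measurable_EFinP.
pose s := nnsfun_approx measurableT mEh.
have ms n : measurable_fun setT (fun w => s n (X w)).
  by apply: measurableT_comp mX; exact: measurable_funP.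
have sh x : (s n x)%:E @[n --> \oo] --> (h x)%:E.
  by apply: (@cvg_nnsfun_approx _ _ _ _ measurableT _ mEh) => // y _; rewrite lee_fin.
have snd x m n : (m <= n)%N -> s m x <= s n x.
  by move=> mn; exact/lefP/nd_nnsfun_approx.
have cvl : (\int[P]_w (s n (X w) * g w)%:E @[n --> \oo] -->
            \int[P]_w (h (X w) * g w)%:E)%E.
  rewrite (_ : (fun w => (h (X w) * g w)%:E) =
    (fun w => lim ((s n (X w) * g w)%:E @[n --> \oo]))).
    apply: cvg_monotone_convergence => //.
    - by move=> n; apply/measurable_EFinP; exact: measurable_funM.
    - by move=> n w _; rewrite lee_fin mulr_ge0.
    - by move=> w _ m n mn; rewrite lee_fin ler_wpM2r// snd.
  apply/funext => w; apply/esym/cvg_lim => //.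
  under eq_fun do rewrite EFinM.
  by rewrite EFinM; apply: cvgeZr => //; exact: sh.
have cvr : (\int[P]_w (s n (X w))%:E @[n --> \oo] -->
            \int[P]_w (h (X w))%:E)%E.
  rewrite (_ : (fun w => (h (X w))%:E) =
    (fun w => lim ((s n (X w))%:E @[n --> \oo]))).
    apply: cvg_monotone_convergence => //.
    - by move=> n; apply/measurable_EFinP.
    - by move=> n w _; rewrite lee_fin.
    - by move=> w _ m n mn; rewrite lee_fin snd.
  by apply/funext => w; apply/esym/cvg_lim => //; exact: sh.
apply: cvg_unique cvl _ => //.
have -> : (fun n => \int[P]_w (s n (X w) * g w)%:E)%E =
    (fun n => \int[P]_w (s n (X w))%:E * c%:E)%E.
  by apply/funext => n; exact: integral_nnsfun_comp_mul.
exact: cvgeZr.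
Qed.

End integral_comp_indic.

(** * Product formula for expectations of independent variables *)

Section independent_product.
Context {d : measure_display} {T : measurableType d} {R : realType}.
Variables (P : probability T R) (I : finType) (Y : I -> T -> R).
Hypotheses (mY : forall i, measurable_fun setT (Y i)).
Hypothesis indep : mutually_independent P Y.

Let measurable_prod_comp (Q : pred I) (f : I -> R -> R) :
  (forall i, measurable_fun setT (f i)) ->
  measurable_fun setT (fun w => \prod_(i | Q i) f i (Y i w)).
Proof.
move=> mf; rewrite [X in measurable_fun _ X](_ : _ =
    (fun w => \prod_(i <- [seq i <- index_enum I | Q i]) f i (Y i w))).
  by apply: measurable_prod => i _; exact: measurableT_comp (mf i) (mY i).
by apply/funext => w; rewrite big_filter.
Qed.

Lemma integral_prod_ge0 (f : I -> R -> R) :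
  (forall i, measurable_fun setT (f i)) -> (forall i x, 0 <= f i x) ->
  (forall i, (\int[P]_w (f i (Y i w))%:E < +oo)%E) ->
  (\int[P]_w (\prod_i f i (Y i w))%:E = \prod_i \int[P]_w (f i (Y i w))%:E)%E.
Proof.
(* For indicators this is the product rule on events; indicators are then replaced
   by general functions one index at a time, so no pi-lambda argument is needed. *)
suff H (s : seq I) (f' : I -> R -> R) :
    (forall i, measurable_fun setT (f' i)) -> (forall i x, 0 <= f' i x) ->
    (forall i, (\int[P]_w (f' i (Y i w))%:E < +oo)%E) ->
    (forall i, i \notin s -> exists2 B, measurable B & f' i = \1_B) ->
  (\int[P]_w (\prod_i f' i (Y i w))%:E = \prod_i \int[P]_w (f' i (Y i w))%:E)%E.
  by move=> mf f0 foo; apply: (H (enum I)) => // i; rewrite mem_enum.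
elim: s f' => [|i s IH] {}f mf f0 foo fB.
  have {}fB i : exists B, measurable B /\ f i = \1_B by have [B] := fB i isT; exists B.
  have [B BP] := choice fB.
  have fE i w : f i (Y i w) = \1_(Y i @^-1` B i) w by rewrite (BP i).2 !indicE.
  have mYB i : measurable (Y i @^-1` B i).
    by rewrite -[X in measurable X]setTI; apply: mY => //; exact: (BP i).1.
  (* A product of indicators is the indicator of the intersection of the preimages; independence is
     then used with the full index set. *)
  transitivity (P (\bigcap_(i in [set` [set: I]%SET]) (Y i @^-1` B i))).
    rewrite -[X in P X]setIT -integral_indic//; last first.
      by apply: fin_bigcap_measurable => //; exact: finite_finset.
    apply: eq_integral => w _; congr EFin; rewrite indicE.
    case: (boolP (w \in _)) => [|/negP wB].
      rewrite inE => wB; apply: big1 => i _; rewrite fE indicE mem_set//.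
      by apply: wB; rewrite /= finset.in_setT.
    have [i iB] : exists i, ~ (Y i @^-1` B i) w.
      by apply: contra_notP wB => /forallNP wB; rewrite inE => i _; exact: contrapT.
    by rewrite (bigD1 i)//= fE indicE memNset// mul0r.
  rewrite (indep [set: I]%SET B); last by move=> i; exact: (BP i).1.
  rewrite (eq_bigl predT) => [|i]; last by rewrite finset.in_setT.
  apply: eq_bigr => i _; under eq_integral do rewrite fE.
  by rewrite integral_indic// setIT.
(* With [h] an indicator, only indices in [s] can carry a general function in [F h], so the
   induction hypothesis supplies the factorization that [integral_ge0_comp_mul] assumes. *)
pose F h : I -> R -> R := fun j => if j == i then h else f j.
have prodF h w : \prod_j F h j (Y j w) = h (Y i w) * \prod_(j | j != i) f j (Y j w).
  rewrite (bigD1 i)//= /F eqxx; congr (_ * _); apply: eq_bigr => j /negbTE -> //.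
pose c := (\prod_(j | j != i) \int[P]_w (f j (Y j w))%:E)%E.
have int0 j : (0 <= \int[P]_w (f j (Y j w))%:E)%E.
  by apply: integral_ge0 => w _; rewrite lee_fin.
(* Finite expectations make [c] a real number, as the weight in [integral_ge0_comp_mul] has to
   be. *)
have cfin : c \is a fin_num.
  by apply: prode_fin_num => j _; rewrite ge0_fin_numE.
have c0 : (0 <= c)%E by exact: prode_ge0.
rewrite [RHS](bigD1 i)//= -/c -(fineK cfin).
under eq_integral do rewrite (bigD1 i)//=.
apply: integral_ge0_comp_mul => //.
- exact: measurable_prod_comp.
- by move=> w; apply: prodr_ge0.
move=> B mB; rewrite (fineK cfin).
under eq_integral do rewrite -prodF.
rewrite IH /F.
- rewrite (bigD1 i)//= eqxx; congr (_ * _)%E.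
  by apply: eq_bigr => j /negbTE -> .
- by move=> j; case: eqP => // _; exact: measurable_indic.
- by move=> j x; case: eqP.
- move=> j; case: eqP => // ->.
  rewrite (@le_lt_trans _ _ (\int[P]_w (cst 1%:E w))%E)//.
    apply: ge0_le_integral => //; last first.
      by move=> w _; rewrite lee_fin indicE; case: (_ \in _).
    apply/measurable_EFinP; apply: measurableT_comp (mY i).
    exact: measurable_indic.
  by rewrite integral_cst//= probability_setT mule1 ltry.
- move=> j js; case: eqP => [_|/eqP ji]; first by exists B.
  by apply: fB; rewrite inE negb_or ji.
Qed.

(** By the nonnegative product formula applied to the absolute values, the expectation of the
    absolute product is a finite product of finite numbers. *)
Lemma integrable_prod_indep (f : I -> R -> R) :
  (forall i, measurable_fun setT (f i)) ->
  (forall i, P.-integrable setT (fun w => (f i (Y i w))%:E)) ->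
  P.-integrable setT (fun w => (\prod_i f i (Y i w))%:E).
Proof.
move=> mf fint; apply/integrableP; split.
  by apply/measurable_EFinP; exact: measurable_prod_comp.
under eq_integral do rewrite abse_EFin normr_prod.
have foo i : (\int[P]_w (`|f i (Y i w)|)%:E < +oo)%E.
  by have /integrableP[_] := fint i.
rewrite (integral_prod_ge0 (fun i x => `|f i x|))//; last first.
  by move=> i; exact: measurableT_comp.
rewrite -ge0_fin_numE; last first.
  by apply: prode_ge0 => i _; apply: integral_ge0 => w _; rewrite lee_fin.
apply: prode_fin_num => i _; rewrite ge0_fin_numE//.
by apply: integral_ge0 => w _; rewrite lee_fin.
Qed.

Lemma integral_prod_indep (f : I -> R -> R) :
  (forall i, measurable_fun setT (f i)) ->
  (forall i, P.-integrable setT (fun w => (f i (Y i w))%:E)) ->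
  (\int[P]_w (\prod_i f i (Y i w))%:E = \prod_i \int[P]_w (f i (Y i w))%:E)%E.
Proof.
(* Both sides are linear in each [f i]: split it as [(f i)^\+ - (f i)^\-], index by index. *)
suff H (s : seq I) (f' : I -> R -> R) :
    (forall i, measurable_fun setT (f' i)) ->
    (forall i, P.-integrable setT (fun w => (f' i (Y i w))%:E)) ->
    (forall i, i \notin s -> forall x, 0 <= f' i x) ->
  (\int[P]_w (\prod_i f' i (Y i w))%:E = \prod_i \int[P]_w (f' i (Y i w))%:E)%E.
  by move=> mf fint; apply: (H (enum I)) => // i; rewrite mem_enum.
elim: s f' => [|i s IH] {}f mf fint f0.
  apply: integral_prod_ge0 => // [i|i]; first exact: f0.
  have /integrableP[_] := fint i.
  by under eq_integral do rewrite abse_EFin ger0_norm ?f0//.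
pose F h : I -> R -> R := fun j => if j == i then h else f j.
have prodF h w : \prod_j F h j (Y j w) = h (Y i w) * \prod_(j | j != i) f j (Y j w).
  rewrite (bigD1 i)//= /F eqxx; congr (_ * _); apply: eq_bigr => j /negbTE -> //.
have eprodF h : (\prod_j \int[P]_w (F h j (Y j w))%:E =
    \int[P]_w (h (Y i w))%:E * \prod_(j | j != i) \int[P]_w (f j (Y j w))%:E)%E.
  rewrite (bigD1 i)//= /F eqxx; congr (_ * _)%E; apply: eq_bigr => j /negbTE -> //.
have mF h : measurable_fun setT h -> forall j, measurable_fun setT (F h j).
  by move=> mh j; rewrite /F; case: eqP.
have Fint h : P.-integrable setT (fun w => (h (Y i w))%:E) ->
    forall j, P.-integrable setT (fun w => (F h j (Y j w))%:E).
  by move=> hint j; rewrite /F; case: eqP => // ->.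
have F0 h : (forall x, 0 <= h x) -> forall j, j \notin s -> forall x, 0 <= F h j x.
  move=> h0 j js x; rewrite /F; case: eqP => // /eqP ji.
  by apply: f0; rewrite inE negb_or ji.
have mp : measurable_fun setT (f i)^\+ by exact: measurable_funrpos.
have mn : measurable_fun setT (f i)^\- by exact: measurable_funrneg.
have pint : P.-integrable setT (fun w => ((f i)^\+ (Y i w))%:E).
  exact: (integrable_funrpos measurableT (fint i)).
have nint : P.-integrable setT (fun w => ((f i)^\- (Y i w))%:E).
  exact: (integrable_funrneg measurableT (fint i)).
have fE x : f i x = (f i)^\+ x - (f i)^\- x.
  by rewrite -[in LHS](funrposBneg (f i)).
have ip := integrable_prod_indep _ (mF _ mp) (Fint _ pint).
have im := integrable_prod_indep _ (mF _ mn) (Fint _ nint).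
rewrite [RHS](bigD1 i)//=.
under eq_integral do rewrite (bigD1 i)//= fE mulrBl -!prodF EFinB.
rewrite (integralB_EFin measurableT ip im).
rewrite !IH; try by [apply: mF|apply: Fint|apply: F0].
(* Factoring the difference in the extended reals needs a finite common factor and a well-defined
   difference. *)
rewrite !eprodF -muleBl; last 2 first.
  by apply: prode_fin_num => j _; exact: integrable_fin_num.
  by apply: fin_num_adde_defr; exact: integrable_fin_num.
congr (_ * _)%E; under [RHS]eq_integral do rewrite fE EFinB.
by rewrite (integralB_EFin measurableT pint nint).
Qed.

End independent_product.

(** * Second moment of the permanent and Chebyshev's bound *)

Section permanent_second_moment.
Context {d : measure_display} {T : measurableType d} {R : realType}.
Variable P : probability T R.

(** Iterating the moment condition down to the zeroth moment, which is 1, collects the factorial and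
    the power of [L]. For [L = 1] and [i = 2] the bound is 2. *)
Lemma moment_boundedW (L : R) (Z : T -> R) (i : nat) : 0 <= L ->
  moment_bounded P L Z -> (\int[P]_w (`|Z w| ^+ i)%:E <= (i`!%:R * L ^+ i)%:E)%E.
Proof.
move=> L0 ZL; elim: i => [|i IH].
  under eq_integral do rewrite expr0.
  by rewrite integral_cst//= probability_setT mule1 fact0 expr0 mulr1.
have := ZL i.+1 isT; rewrite !unlock => /le_trans; apply.
rewrite (_ : (i.+1)`!%:R * L ^+ i.+1 = i.+1%:R * L * (i`!%:R * L ^+ i)); last first.
  by rewrite factS natrM exprS mulrACA.
by rewrite [in leRHS]EFinM lee_wpmul2l// lee_fin mulr_ge0.
Qed.

Lemma moment_bounded_integrable (L : R) (Z : T -> R) (i : nat) : 0 <= L ->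
  measurable_fun setT Z -> moment_bounded P L Z ->
  P.-integrable setT (fun w => (Z w ^+ i)%:E).
Proof.
move=> L0 mZ ZL; apply/integrableP; split.
  by apply/measurable_EFinP; exact: measurable_funX.
under eq_integral do rewrite abse_EFin normrX.
exact: le_lt_trans (moment_boundedW L Z i L0 ZL) (ltry _).
Qed.

(** Writing a monomial over all entries with exponents 0 or 1 puts it in the form of the product
    formula, and lets two monomials be multiplied by adding exponents. *)
Lemma prod_expr_pred1 (n : nat) (s : 'S_n) (x : 'I_n -> 'I_n -> R) :
  \prod_(ij : 'I_n * 'I_n) x ij.1 ij.2 ^+ (s ij.1 == ij.2) = \prod_i x i (s i).
Proof.
rewrite -(pair_bigA _ (fun i j => x i j ^+ (s i == j)))/=.
apply: eq_bigr => i _; rewrite (bigD1 (s i))//= eqxx expr1 big1 ?mulr1// => j.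
by rewrite eq_sym => /negbTE ->.
Qed.

Variables (n : nat) (Y : 'I_n -> 'I_n -> T -> R) (v : R).
Hypotheses (mY : forall i j, measurable_fun setT (Y i j)).
Hypothesis indep : mutually_independent P (fun ij : 'I_n * 'I_n => Y ij.1 ij.2).
Hypothesis Yint : forall i j k, (k <= 2)%N ->
  P.-integrable setT (fun w => (Y i j w ^+ k)%:E).
Hypothesis Y0 : forall i j, (\int[P]_w (Y i j w)%:E = 0)%E.
Hypothesis Yv : forall i j, (\int[P]_w (Y i j w ^+ 2)%:E <= v%:E)%E.

(* Exponent of [Y i j] in the product of the monomials of [s] and [u]. *)
Let a (s u : 'S_n) (ij : 'I_n * 'I_n) := ((s ij.1 == ij.2) + (u ij.1 == ij.2))%N.

Let a2 s u ij : (a s u ij <= 2)%N.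
Proof. by rewrite /a; case: eqP => _; case: eqP. Qed.

Let prod_monomials (s u : 'S_n) w :
  (\prod_i Y i (s i) w) * (\prod_i Y i (u i) w) =
  \prod_(ij : 'I_n * 'I_n) Y ij.1 ij.2 w ^+ a s u ij.
Proof.
rewrite -(prod_expr_pred1 _ s (fun i j => Y i j w)).
rewrite -(prod_expr_pred1 _ u (fun i j => Y i j w)) -big_split/=.
by apply: eq_bigr => ij _; rewrite -exprD.
Qed.

Let integrable_monomials (s u : 'S_n) : P.-integrable setT
  (fun w => ((\prod_i Y i (s i) w) * (\prod_i Y i (u i) w))%:E).
Proof.
under eq_fun do rewrite prod_monomials.
apply: (integrable_prod_indep P _ _ _ indep (fun ij x => x ^+ a s u ij)).
- by move=> ij; exact: mY.
- by move=> ij; exact: exprn_measurable.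
- by move=> ij; apply: Yint; exact: a2.
Qed.

(** If [s = u], the [n] chosen entries occur squared and the others with exponent 0. Otherwise, in a
    row [i] where [s] and [u] differ, the entry at [(i, s i)] occurs exactly once, and its zero mean
    kills the product. *)
Let integral_monomials (s u : 'S_n) :
  (\int[P]_w ((\prod_i Y i (s i) w) * (\prod_i Y i (u i) w))%:E <=
   (if s == u then v ^+ n else 0)%:E)%E.
Proof.
under eq_integral do rewrite prod_monomials.
rewrite (integral_prod_indep P _ _ _ indep (fun ij x => x ^+ a s u ij)); last 3 first.
- by move=> ij; exact: mY.
- by move=> ij; exact: exprn_measurable.
- by move=> ij; apply: Yint; exact: a2.
case: (eqVneq s u) => [<-|su].
  rewrite -(pair_bigA _ (fun i j => \int[P]_w (Y i j w ^+ a s s (i, j))%:E)%E)/=.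
  rewrite -[in leRHS](card_ord n) -prodr_const.
  (* Nonnegativity is carried along with the bound, since inequalities between factors can be
     multiplied only for nonnegative factors. *)
  apply: (proj2 (A := 0 <= _)%E).
  apply: (big_ind2 (fun x y => 0 <= x /\ x <= y%:E)%E).
  - by rewrite lexx lee01.
  - by move=> x1 y1 x2 y2 [x10 xy1] [x20 xy2]; rewrite mule_ge0// EFinM lee_pmul.
  move=> i _.
  have int0 j : (0 <= \int[P]_w (Y i j w ^+ a s s (i, j))%:E)%E.
    apply: integral_ge0 => w _; rewrite lee_fin /a addnn.
    by rewrite -muln2 mulnC exprM exprn_ge0// sqr_ge0.
  split; first by rewrite prode_ge0.
  rewrite (bigD1 (s i))//= {1}/a eqxx big1 ?mule1// => j.
  rewrite eq_sym /a => /negbTE -> /=; under eq_integral do rewrite expr0.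
  by rewrite integral_cst//= probability_setT mule1.
have [i sui] : exists i, s i != u i.
  apply/existsP; apply: contraNT su; rewrite negb_exists => /forallP su.
  by apply/eqP/permP => i; apply/eqP; rewrite -[_ == _]negbK.
rewrite (bigD1 (i, s i))//= /a eqxx/= eq_sym (negbTE sui).
under eq_integral do rewrite expr1.
by rewrite Y0 mul0e.
Qed.

(** The square expands into a double sum over permutations, in which only the diagonal terms
    contribute. *)
Lemma integral_rperm_sqr :
  (\int[P]_w (rperm Y w ^+ 2)%:E <= (n`!%:R * v ^+ n)%:E)%E.
Proof.
have E w : (rperm Y w ^+ 2)%:E = (\sum_(s : 'S_n) \sum_(u : 'S_n)
    ((\prod_i Y i (s i) w) * (\prod_i Y i (u i) w))%:E)%E.
  rewrite expr2 /rperm mulr_suml -sumEFin; apply: eq_bigr => s _.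
  by rewrite mulr_sumr -sumEFin.
under eq_integral do rewrite E.
(* The terms are signed, so exchanging sum and integral rests on [integrable_monomials]. *)
rewrite integral_sum//; last by move=> s; exact: integrable_sum.
apply: (@le_trans _ _ (\sum_(s : 'S_n) (v ^+ n)%:E)%E).
  apply: lee_sum => s _; rewrite integral_sum//.
  apply: le_trans (lee_sum _ (fun u _ => integral_monomials s u)) _.
  rewrite sumEFin lee_fin (bigD1 s)//= eqxx big1 ?addr0// => u.
  by rewrite eq_sym => /negbTE ->.
rewrite sumEFin lee_fin sumr_const.
by rewrite card_Sn mulr_natl.
Qed.

Lemma measurable_rperm : measurable_fun setT (rperm Y).
Proof.
by apply: measurable_sum => s; apply: measurable_prod => i _; exact: mY.
Qed.

Lemma rperm_chebyshev (e : R) : 0 < e ->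
  (P [set w | (e <= `|rperm Y w|)%R] <= (n`!%:R * v ^+ n / e ^+ 2)%:E)%E.
Proof.
move=> e0; pose X : {mfun T >-> R} := mfun_Sub (mem_set measurable_rperm).
have := @markov _ _ _ P X (fun x => x ^+ 2) e e0 (exprn_measurable 2).
move=> /(_ (fun r _ => sqr_ge0 r)) M.
have {}M := M (fun x y x0 y0 => lerXn2r 2 x0 y0).
rewrite [X in P X](_ : _ = [set w | e%:E <= `|(X w)%:E|]%E); last first.
  by apply/seteqP; split=> w /=; rewrite lee_fin.
rewrite (mulrC _ (e ^+ 2)^-1) EFinM lee_pdivlMl ?exprn_gt0//.
apply: le_trans M _; rewrite unlock.
by under eq_integral do rewrite /= real_normK ?num_real//; exact: integral_rperm_sqr.
Qed.

End permanent_second_moment.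

(** * Tail bound: the constant and the two ranges of [t] *)

Theorem theorem5 (R : realType) :
  exists c : R, 0 < c /\
  forall (d : measure_display) (T : measurableType d) (P : probability T R)
         (n : nat) (Y : 'I_n -> 'I_n -> {RV P >-> R}),
    (0 < n)%N ->
    mutually_independent P (fun ij : 'I_n * 'I_n => (Y ij.1 ij.2 : T -> R)) ->
    (forall i j, moment_bounded P 1 (Y i j)) ->
    (forall i j, ('E_P[Y i j] = 0)%E) ->
    forall t : R, 0 < t ->
      (P [set w | (t * Num.sqrt (n`!)%:R <= `|rperm (fun i j => (Y i j : T -> R)) w|)%R]
        <= maxe (expR (- n%:R))%:E
                ((expR 2 * expR (- c * t `^ (2 / n%:R)))%:E))%E.
Proof.
(* The value 1/e lets a single threshold, comparing [x / e] with 2, serve both cases: up to it the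
   second bound is at least 1, beyond it [2 / x] is below 1/e. *)
exists (expR (-1)); split; first exact: expR_gt0.
move=> d T P n Y n0 indep Y1 Y0 t t0.
set x := t `^ _.
have x0 : 0 < x by exact: powR_gt0.
(* Positivity of [n] is what cancels the exponent [2 / n] against [n]. *)
have xn : x ^+ n = t ^+ 2.
  by rewrite -powR_mulrn ?ltW// -powRrM mulfVK ?pnatr_eq0 -?lt0n// powR_mulrn// ltW.
have mY i j : measurable_fun setT (Y i j : T -> R) by exact: measurable_funP.
have [xle|xgt] := leP (expR (-1) * x) 2.
  rewrite le_max; apply/orP; right.
  apply: le_trans (probability_le1 _ _) _.
    rewrite -[X in measurable X]setTI; apply: measurable_fun_le => //.
    by apply: measurableT_comp => //; exact: measurable_rperm.
  by rewrite lee_fin -expRD -[leLHS]expR0 ler_expR mulNr subr_ge0.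
rewrite le_max; apply/orP; left.
apply: (@le_trans _ _ (n`!%:R * 2 ^+ n / (t * Num.sqrt n`!%:R) ^+ 2)%:E).
  apply: rperm_chebyshev => //.
  - move=> i j k _; exact: (moment_bounded_integrable _ 1).
  - by move=> i j; rewrite -(Y0 i j) unlock.
  - move=> i j; have := moment_boundedW _ 1 (Y i j) 2 ler01 (Y1 i j).
    rewrite expr1n mulr1.
    by under eq_integral do rewrite real_normK ?num_real//.
  - by rewrite mulr_gt0// sqrtr_gt0 ltr0n fact_gt0.
(* The factorials cancel and leave [(2 / x) ^+ n], to be compared with the [n]-th power of 1/e base
   by base. *)
rewrite lee_fin exprMn sqr_sqrtr// -xn (mulrC _ n`!%:R) -mulf_div.
rewrite divff ?pnatr_eq0 -?lt0n ?fact_gt0// mul1r -expr_div_n.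
rewrite -mulN1r expRM_natr; apply: lerXn2r; rewrite ?nnegrE ?divr_ge0 ?expR_ge0 ?ltW//.
by rewrite ltr_pdivrMr.
Qed.
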